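(* Let $A$ be a nonempty set and let $(A;\wedge)$ be a semilattice that has an identity element $1$ and a zero element $0$. Let $\mathcal{C}$ be a clone on $A$ such that $\langle\wedge\rangle\subseteq\mathcal{C}\subseteq\langle\wedge,0,1\rangle$. Then the $\mathcal{C}$-minor partial order $\preccurlyeq_{\mathcal{C}}$ on $\mathcal{O}_A/{\equiv_{\mathcal{C}}}$ satisfies the descending chain condition.
   Context: Let $A$ be a nonempty (not necessarily finite) set. An operation on $A$ is a map $f\colon A^n \to A$ for some integer $n \geq 1$ (its arity). $\mathcal{O}_A$ denotes the set of all operations on $A$ (of all arities $n\ge 1$). The $i$-th $n$-ary projection is $(a_1,\dots,a_n)\mapsto a_i$. For $f$ of arity $n$ and $g_1,\dots,g_n$ all of arity $m$, the composition $f(g_1,\dots,g_n)$ is the $m$-ary operation $\mathbf{a} \mapsto f(g_1(\mathbf{a}),\dots,g_n(\mathbf{a}))$. A clone on $A$ is a set $\mathcal{C}\subseteq\mathcal{O}_A$ containing all projections and closed under composition (whenever the composition is defined). For $F\subseteq \mathcal{O}_A$, $\langle F\rangle$ denotes the smallest clone on $A$ containing $F$. A semilattice $(A;\wedge)$ is a set with a binary operation $\wedge$ that is associative, commutative and idempotent ($x\wedge x=x$). An identity element is $1\in A$ with $1\wedge x=x$ for all $x\in A$; a zero element is $0\in A$ with $0\wedge x=0$ for all $x\in A$. In $\langle\wedge,0,1\rangle$ the symbols $0$ and $1$ stand for the constant (say unary) operations on $A$ with values $0$ and $1$. For a clone $\mathcal{C}$ on $A$ and $f,g\in\mathcal{O}_A$,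 with $f$ of arity $n$ and $g$ of arity $m$, $f$ is a $\mathcal{C}$-minor of $g$, written $f\leq_{\mathcal{C}} g$, if $f = g(h_1,\dots,h_m)$ for some ($n$-ary) $h_1,\dots,h_m\in\mathcal{C}$. The relation $\leq_{\mathcal{C}}$ is a preorder on $\mathcal{O}_A$. Write $f\equiv_{\mathcal{C}} g$ if $f\leq_{\mathcal{C}} g$ and $g\leq_{\mathcal{C}} f$. The $\mathcal{C}$-minor partial order $\preccurlyeq_{\mathcal{C}}$ is the partial order induced by $\leq_{\mathcal{C}}$ on the quotient $\mathcal{O}_A/{\equiv_{\mathcal{C}}}$. A partial order $(P;\leq)$ satisfies the descending chain condition if for every sequence $\cdots\leq a_3\leq a_2\leq a_1$ of elements of $P$ there is a positive integer $n$ such that $a_n=a_{n+1}=a_{n+2}=\cdots$. *)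

(* Defs.v *)
From mathcomp Require Import all_boot.
From mathcomp Require Import all_classical.

Set Implicit Arguments.
Unset Strict Implicit.
Unset Printing Implicit Defensive.

Local Open Scope classical_set_scope.

(* Arities are at least 1, so [op A n] is the type of operations of arity
   n.+1. *)
Definition op (A : Type) (n : nat) : Type := n.+1.-tuple A -> A.

Definition operation (A : Type) : Type := {n : nat & op A n}.

Definition operation_of (A : Type) (n : nat) (f : op A n) : operation A :=
  existT (op A) n f.

Definition proj_op (A : Type) (n : nat) (i : 'I_n.+1) : op A n :=
  fun a => tnth a i.

Definition comp_op (A : Type) (n m : nat) (f : op A n) (g : 'I_n.+1 -> op A m) :
    op A m :=
  fun a => f [tuple g i a | i < n.+1].

Definition is_clone (A : Type) (C : set (operation A)) : Prop :=
  (forall (n : nat) (i : 'I_n.+1), C (operation_of (@proj_op A n i))) /\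
  (forall (n m : nat) (f : op A n) (g : 'I_n.+1 -> op A m),
     C (operation_of f) -> (forall i, C (operation_of (g i))) ->
     C (operation_of (comp_op f g))).

Definition clone_generated (A : Type) (F : set (operation A)) :
    set (operation A) :=
  smallest (@is_clone A) F.

Definition binary_operation (A : Type) (b : A -> A -> A) : operation A :=
  operation_of (fun a : 2.-tuple A => b (tnth a ord0) (tnth a ord_max)).

Definition constant_operation (A : Type) (c : A) : operation A :=
  operation_of (fun _ : 1.-tuple A => c).

Definition is_semilattice (A : Type) (meet : A -> A -> A) : Prop :=
  [/\ associative meet, commutative meet & idempotent_op meet].

Definition minor (A : Type) (C : set (operation A)) (f g : operation A) : Prop :=
  exists h : 'I_(tag g).+1 -> op A (tag f),
    (forall i, C (operation_of (h i))) /\ tagged f = comp_op (tagged g) h.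

(* For a preorder [le] on [T], the elements of the quotient of [T] by the
   induced equivalence are the equivalence classes, as subsets of [T]. *)
Definition preorder_class (T : Type) (le : T -> T -> Prop) (x : T) : set T :=
  [set y | le x y /\ le y x].

Definition preorder_quotient (T : Type) (le : T -> T -> Prop) : Type :=
  {X : set T | exists x, X = preorder_class le x}.

Definition quotient_le (T : Type) (le : T -> T -> Prop)
    (X Y : preorder_quotient le) : Prop :=
  exists x y, [/\ sval X x, sval Y y & le x y].

Definition minor_order (A : Type) (C : set (operation A)) :
    preorder_quotient (minor C) -> preorder_quotient (minor C) -> Prop :=
  @quotient_le (operation A) (minor C).

Definition descending_chain_condition (P : Type) (le : P -> P -> Prop) : Prop :=
  forall a : nat -> P, (forall i, le (a i.+1) (a i)) ->
  exists n, forall m, n <= m -> a m = a n.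

Lemma minor_refl (A : Type) (C : set (operation A)) :
  is_clone C -> forall f, minor C f f.
Proof.
move=> [Cproj _] [n f]; exists (@proj_op A n); split=> //=.
apply/funext => a; rewrite /comp_op; congr f.
by apply: eq_from_tnth => i; rewrite tnth_mktuple.
Qed.

Lemma minor_trans (A : Type) (C : set (operation A)) :
  is_clone C -> forall f g k, minor C f g -> minor C g k -> minor C f k.
Proof.
move=> [_ Ccomp] [n f] [m g] [p k] [/= h [Ch ->]] [/= h' [Ch' ->]].
exists (fun i => comp_op (h' i) h); split=> [i|]; first exact: Ccomp.
by apply/funext => a; rewrite /comp_op; congr k.
Qed.

Lemma quotient_le_partial_order (T : Type) (le : T -> T -> Prop) :
  (forall x, le x x) -> (forall x y z, le x y -> le y z -> le x z) ->
  [/\ forall X : preorder_quotient le, quotient_le X X,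
      forall X Y : preorder_quotient le,
        quotient_le X Y -> quotient_le Y X -> X = Y
    & forall X Y Z : preorder_quotient le,
        quotient_le X Y -> quotient_le Y Z -> quotient_le X Z].
Proof.
move=> lexx letr; split.
- by move=> [X [x hX]]; exists x, x; split=> //=; rewrite hX.
- move=> [X [x hX]] [Y [y hY]] [a [b [/= Xa Yb ab]]] [c [d [/= Yc Xd cd]]].
  apply: eq_exist => /=; rewrite hX in Xa Xd *; rewrite hY in Yb Yc *.
  have xy : le x y by case: Xa Yb => xa _ [_ by_]; apply: letr xa (letr _ _ _ ab by_).
  have yx : le y x by case: Yc Xd => yc _ [_ dx]; apply: letr yc (letr _ _ _ cd dx).
  apply/seteqP; split=> z [h1 h2]; split.
  + exact: letr yx h1.
  + exact: letr h2 xy.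
  + exact: letr xy h1.
  + exact: letr h2 yx.
- move=> [X hX] [Y [y hY]] [Z hZ] [a [b [/= Xa Yb ab]]] [c [d [/= Yc Zd cd]]].
  exists a, d; split=> //=; rewrite hY in Yb Yc.
  case: Yb Yc => _ by_ [yc _].
  exact: letr ab (letr _ _ _ by_ (letr _ _ _ yc cd)).
Qed.

Lemma minor_order_partial_order (A : Type) (C : set (operation A)) :
  is_clone C ->
  [/\ forall X, @minor_order A C X X,
      forall X Y, @minor_order A C X Y -> minor_order Y X -> X = Y
    & forall X Y Z, @minor_order A C X Y -> minor_order Y Z -> minor_order X Z].
Proof.
move=> cloneC; apply: quotient_le_partial_order.
- exact: minor_refl.
- exact: minor_trans.
Qed.

(* Main.v *)
Require Import Defs.
From mathcomp Require Import all_boot.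
From mathcomp Require Import all_classical.

(** Every principal down-set of the C-minor order is finite. If
    f = g(h_1, ..., h_m), then each h_i is the constant 0 or the meet of a set
    S_i of variables (the constant 1 if S_i is empty). Let
    T_j = {i : j in S_i}. Variables x_j with the same T_j occur in f only
    through their meet, so f is equivalent to the operation obtained from it by
    identifying them. Using the sets T_j as names of variables, the latter is a
    C-minor of g of an arity that depends only on m; there are finitely many of
    these, since C has finitely many operations of each arity. *)

Local Open Scope classical_set_scope.

Lemma infinitely_often_value {K : finType} (c : nat -> K) :
  exists k, forall n, exists2 m, n <= m & c m = k.
Proof.
apply: contrapT => /forallNP no_k.
have /choice [b bP] (k : K) : exists b, forall m, b <= m -> c m <> k.
  have /existsNP [b nb] := no_k k; exists b => m bm cmk; apply: nb.
  by exists m.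
(* Past the largest of the bounds [b k], no value is left for [c] to take. *)
exact: (bP (c (\max_k b k)) (\max_k b k) (leq_bigmax _)).
Qed.

(** The chain stays in the finite down-set of [a 0], so some value recurs beyond every index;
    antisymmetry squeezes each later term between two occurrences of it. *)
Lemma dcc_of_finite_downsets {P : Type} (le : P -> P -> Prop) :
  (forall x, le x x) ->
  (forall x y, le x y -> le y x -> x = y) ->
  (forall x y z, le x y -> le y z -> le x z) ->
  (forall x, exists (K : finType) (G : K -> P), [set y | le y x] `<=` range G) ->
  descending_chain_condition le.
Proof.
move=> le_refl le_anti le_trans fin_down a a_desc.
have le_a i j : i <= j -> le (a j) (a i).
  move=> /subnK <-; elim: (j - i) => // d IHd.
  exact: le_trans (a_desc _) IHd.
have [K [G downG]] := fin_down (a 0).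
have /choice [c cP] i : exists k, G k = a i.
  by have [k _ <-] := downG _ (le_a 0 i (leq0n i)); exists k.
have [k k_often] := infinitely_often_value c.
have [n _ cn] := k_often 0; exists n => m nm.
have [p mp cp] := k_often m.
have pn : a p = a n by rewrite -!cP cp cn.
by apply: le_anti; [exact: le_a | rewrite -pn; exact: le_a].
Qed.

Lemma quotient_finite_downsets {T : Type} (le : T -> T -> Prop) :
  (forall x, le x x) -> (forall x y z, le x y -> le y z -> le x z) ->
  (forall x, exists (K : finType) (F : K -> T),
     forall y, le y x -> exists k, preorder_class le (F k) y) ->
  forall X : preorder_quotient le, exists (K : finType) (G : K -> preorder_quotient le),
    [set Y | quotient_le Y X] `<=` range G.
Proof.
move=> le_refl le_trans fin_down [X [x XE]].
have [K [F FP]] := fin_down x; exists K.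
exists (fun k => exist _ (preorder_class le (F k)) (ex_intro _ (F k) erefl)).
move=> [Y [y0 YE]] [y [z [/=]]]; rewrite {1}XE {1}YE => -[y0y yy0] [xz zx] yz.
have [k [ky yk]] := FP y (le_trans _ _ _ yz zx).
exists k => //; apply: eq_exist; rewrite YE.
apply/seteqP; split => w [lw rw]; split.
- exact: (le_trans _ _ _ y0y (le_trans _ _ _ yk lw)).
- exact: (le_trans _ _ _ rw (le_trans _ _ _ ky yy0)).
- exact: (le_trans _ _ _ ky (le_trans _ _ _ yy0 lw)).
- exact: (le_trans _ _ _ rw (le_trans _ _ _ y0y yk)).
Qed.

(** Here [meet y x = y] encodes that y is below x. The starting value [z] is arbitrary and counts as
    one more factor, so a meet can also start from a variable. *)
Lemma le_big_meet {A : Type} {meet : A -> A -> A} {I : eqType}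
    (r : seq I) (P : pred I) (F : I -> A) (y z : A) :
  is_semilattice meet ->
  meet y (\big[meet/z]_(i <- r | P i) F i) = y <->
  meet y z = y /\ forall i, i \in r -> P i -> meet y (F i) = y.
Proof.
move=> [meetA meetC meetxx].
have le_meet a b : meet y (meet a b) = y <-> meet y a = y /\ meet y b = y.
  split=> [yab | [ya yb]]; last by rewrite meetA ya yb.
  split; rewrite -yab.
    by rewrite [meet a b]meetC -!meetA meetxx.
  by rewrite -!meetA meetxx.
elim: r => [|i r IHr]; first by rewrite big_nil; split=> [|[]].
rewrite big_cons; case: ifP => Pi; last first.
  rewrite IHr; split=> -[yz yr]; split=> // j; last first.
    by move=> jr; apply: yr; rewrite inE jr orbT.
  by rewrite inE => /orP [/eqP -> | /yr //]; rewrite Pi.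
rewrite le_meet IHr; split=> [[yi [yz yr]]|[yz yr]].
  by split=> // j; rewrite inE => /orP [/eqP -> // | /yr].
split; first by apply: yr => //; rewrite mem_head.
by split=> // j jr; apply: yr; rewrite inE jr orbT.
Qed.

(** Together with [le_big_meet], this reduces identities between meets to comparing which factors
    occur. *)
Lemma eq_lower_bounds {A : Type} {meet : A -> A -> A} (a b : A) :
  is_semilattice meet ->
  (forall y, meet y a = y <-> meet y b = y) -> a = b.
Proof.
move=> [meetA meetC meetxx] ab.
have abE : meet a b = a by apply/ab.
by rewrite -abE meetC; apply/ab.
Qed.

(** In an n-ary term, [Some i] stands for the i-th variable and [None] for the
    constant zero; the empty meet is [one]. *)
Definition meet_term {A : Type} (meet : A -> A -> A) (zero one : A) {n : nat}
    (S : {set option 'I_n.+1}) : op A n :=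
  fun a => \big[meet/one]_(i <- enum S) oapp (tnth a) zero i.

Lemma le_meet_term {A : Type} {meet : A -> A -> A} {zero one : A} {n : nat}
    (S : {set option 'I_n.+1}) (a : n.+1.-tuple A) (y : A) :
  is_semilattice meet -> left_id one meet ->
  meet y (meet_term meet zero one S a) = y <->
  forall i, i \in S -> meet y (oapp (tnth a) zero i) = y.
Proof.
move=> slat oneI; rewrite (le_big_meet _ _ _ _ _ slat).
split=> [[_ yS] i iS | yS].
  by apply: yS; rewrite ?mem_enum.
split=> [|i]; first by case: slat => _ meetC _; rewrite meetC.
by rewrite mem_enum => /yS.
Qed.

Lemma clone_generated_meet_term {A : Type} {meet : A -> A -> A} {zero one : A} :
  is_semilattice meet -> left_id one meet ->
  clone_generated [set binary_operation meet; constant_operation zero;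
                       constant_operation one] `<=`
  [set f | exists S, tagged f = meet_term meet zero one S].
Proof.
move=> slat oneI; apply: smallest_sub.
  split=> [n i | n m f g [/= S ->] gP].
    exists [set Some i]%SET; apply/funext => a /=.
    apply: (eq_lower_bounds _ _ slat) => y; rewrite le_meet_term //.
    split=> [yi j | yi]; first by rewrite inE => /eqP ->.
    by apply: (yi (Some i)); rewrite inE.
  have /choice [Sg SgP] := gP.
  (* Substituting meets into a meet takes the union of their sets of factors; a zero factor of the
     outer term stays a zero factor. *)
  exists (\bigcup_(i in S) oapp Sg [set None] i)%SET.
  apply/funext => a /=; apply: (eq_lower_bounds _ _ slat) => y.
  rewrite /comp_op !le_meet_term //.
  have SgE i : g i a = meet_term meet zero one (Sg i) a by rewrite -SgP.
  split=> [yS j /finset.bigcupP [[i|] iS] | yS [i|] iS] /=.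
  - move: (yS _ iS); rewrite /= tnth_mktuple SgE le_meet_term //; exact.
  - by rewrite inE => /eqP ->; exact: yS iS.
  - rewrite tnth_mktuple SgE le_meet_term // => j jS.
    by apply: yS; apply/finset.bigcupP; exists (Some i).
  - by apply: (yS None); apply/finset.bigcupP; exists None; rewrite ?inE.
move=> _ [[->|->]|->] /=.
- exists [set Some ord0; Some ord_max]%SET; apply/funext => a.
  apply: (eq_lower_bounds _ _ slat) => y; rewrite le_meet_term //.
  (* The binary meet is the big meet over the first variable, started at the second. *)
  have := le_big_meet [:: ord0] xpredT (tnth a) y (tnth a ord_max) slat.
  rewrite big_seq1_id ?big_cons ?big_nil => ->.
  split=> [[y1 y0] i | yS].
    by rewrite !inE => /orP [] /eqP -> //=; apply: y0; rewrite ?inE.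
  split=> [|i]; first by apply: (yS (Some ord_max)); rewrite !inE eqxx orbT.
  by rewrite inE => /eqP -> _; apply: (yS (Some ord0)); rewrite !inE eqxx.
- exists [set None]%SET; apply/funext => a.
  apply: (eq_lower_bounds _ _ slat) => y; rewrite le_meet_term //.
  split=> [yi j | yi]; first by rewrite inE => /eqP ->.
  by apply: (yi None); rewrite inE.
- exists finset.set0; apply/funext => a.
  by rewrite /meet_term enum_set0 big_nil.
Qed.

(** The meet starts from a variable because the constant [one] may lie outside [C]. *)
Lemma clone_big_meet {A : Type} {meet : A -> A -> A} {C : set (operation A)}
    {n : nat} (i0 : 'I_n.+1) (r : seq 'I_n.+1) (P : pred 'I_n.+1) :
  is_clone C -> C (binary_operation meet) ->
  C (operation_of (fun a : n.+1.-tuple A =>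
       \big[meet/tnth a i0]_(i <- r | P i) tnth a i)).
Proof.
move=> [Cproj Ccomp] Cmeet.
elim: r => [|i r IHr].
  under eq_fun do rewrite big_nil.
  exact: Cproj.
under eq_fun do rewrite big_cons.
case: (P i) => //.
set F := (X in operation_of X) in IHr.
have -> : (fun a : n.+1.-tuple A =>
             meet (tnth a i) (\big[meet/tnth a i0]_(j <- r | P j) tnth a j)) =
    comp_op (fun a : 2.-tuple A => meet (tnth a ord0) (tnth a ord_max))
      (fun j : 'I_2 => if j == ord0 then @proj_op A n i else F).
  by apply/funext => a; rewrite /comp_op !tnth_mktuple.
by apply: Ccomp Cmeet _ => j; case: ifP.
Qed.

Lemma minor_bounded_arity {A : Type} {meet : A -> A -> A} {zero one : A}
    {C : set (operation A)} {n m : nat} (f : op A n) (g : op A m) :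
  is_semilattice meet -> left_id one meet -> is_clone C ->
  C (binary_operation meet) ->
  C `<=` clone_generated [set binary_operation meet; constant_operation zero;
                              constant_operation one] ->
  minor C (operation_of f) (operation_of g) ->
  exists f' : op A #|{set 'I_m.+1}|,
    [/\ minor C (operation_of f') (operation_of g),
        minor C (operation_of f') (operation_of f)
      & minor C (operation_of f) (operation_of f')].
Proof.
move=> slat oneI Cclone Cmeet Cup fg; have [/= h [Ch fE]] := fg.
have /choice [S SP] i : exists S, h i = meet_term meet zero one S.
  exact: (clone_generated_meet_term slat oneI _ (Cup _ (Ch i))).
pose T (j : 'I_n.+1) : {set 'I_m.+1} := [set i | Some j \in S i]%SET.
(* An [op A k] has k + 1 variables, one more than there are names; [lift ord0] leaves variable 0
   unnamed. *)
pose v j : 'I_#|{set 'I_m.+1}|.+1 := lift ord0 (enum_rank (T j)).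
have v_inj j k : v j = v k -> T j = T k.
  by move=> /lift_inj /enum_rank_inj.
pose f' := comp_op f (fun j => @proj_op A _ (v j)).
have f'f : minor C (operation_of f') (operation_of f).
  by exists (fun j => @proj_op A _ (v j)); split=> // j; apply: Cclone.1.
exists f'; split=> //; first exact: (minor_trans Cclone f'f fg).
(* On a nonempty class, [rep k] is a member, so starting from it adds no new factor. On an empty
   class, [u k] is the variable [ord0], still in [C]. *)
pose rep k := odflt ord0 [pick j | v j == k].
pose u k : op A n := fun a => \big[meet/tnth a (rep k)]_(j | v j == k) tnth a j.
exists u; split=> [k|]; first exact: clone_big_meet.
apply/funext => a; rewrite /f' /comp_op /= fE /comp_op.
congr g; apply: eq_mktuple => i; rewrite SP.
apply: (eq_lower_bounds _ _ slat) => y; rewrite !le_meet_term //.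
have uE j : tnth [tuple proj_op (v i) [tuple u k a | k < _] | i < n.+1] j = u (v j) a.
  by rewrite tnth_mktuple /proj_op tnth_mktuple.
split=> yS [j|] jS; try exact: (yS None jS); rewrite /= ?uE.
  apply/(le_big_meet _ _ _ _ _ slat).
  (* Since j is in [S i], so is every variable of its class, and y is below all of them. *)
  have yT k : v k = v j -> meet y (tnth a k) = y.
    move=> /v_inj /setP /(_ i); rewrite !inE jS => kS.
    exact: (yS (Some k)).
  split=> [|k _ /eqP /yT //].
  apply: yT; rewrite /rep; case: pickP => [k /eqP //|].
  by move=> /(_ j); rewrite eqxx.
have := yS _ jS; rewrite /= uE => /(le_big_meet _ _ _ _ _ slat) [_].
by apply; rewrite ?mem_index_enum.
Qed.

Theorem corollary3p2 (A : Type) (meet : A -> A -> A) (zero one : A)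
    (meet_semilattice : is_semilattice meet)
    (one_identity : left_id one meet)
    (zero_zero : left_zero zero meet)
    (C : set (operation A))
    (C_clone : is_clone C)
    (C_lower : clone_generated [set binary_operation meet] `<=` C)
    (C_upper : C `<=` clone_generated
       [set binary_operation meet; constant_operation zero;
            constant_operation one]) :
  descending_chain_condition (@minor_order A C).
Proof.
have Cmeet : C (binary_operation meet) by apply: C_lower; exact: sub_gen_smallest.
have [le_refl le_anti le_trans] := minor_order_partial_order C_clone.
apply: dcc_of_finite_downsets => //.
apply: quotient_finite_downsets.
- exact: minor_refl.
- exact: minor_trans.
move=> [m g]; pose N := #|{set 'I_m.+1}|.
(* One set of factors for each argument of [g]. Some of the listed operations may fail to be minors
   of [g]; it suffices that every minor is equivalent to a listed one. *)
exists {ffun 'I_m.+1 -> {set option 'I_N.+1}}.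
exists (fun k : {ffun _} =>
  operation_of (comp_op g (fun i => meet_term meet zero one (k i)))).
move=> [n f] fg.
have [f' [[/= h [Ch f'E]] f'f ff']] :=
  minor_bounded_arity f g meet_semilattice one_identity C_clone Cmeet C_upper fg.
have /choice [S SP] i : exists S, h i = meet_term meet zero one S.
  exact: (clone_generated_meet_term meet_semilattice one_identity _
            (C_upper _ (Ch i))).
exists (finfun S).
suff -> : comp_op g (fun i => meet_term meet zero one (finfun S i)) = f' by [].
by rewrite f'E; congr (comp_op g); apply/funext => i; rewrite ffunE SP.
Qed.
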